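(* Let $\mathcal{A}$ be an essential central hyperplane arrangement in $\mathbb{R}^d$, $\Bbbk$ a field, and $H$ a hyperplane in $\mathbb{R}^d$ which is generic with respect to $\mathcal{A}$, defined by $f=0$. Let $R(H)=\{\theta(x)\mid x\in\mathbb{R}^d,\ f(x)>0\}$ be the visual hemisphere. Then $\Bbbk R(H)$ is a right ideal of $\Bbbk\mathcal{F}(\mathcal{A})$ and the natural homomorphism of right $\Bbbk\mathcal{F}(\mathcal{A})$-modules $\psi\colon\Bbbk\mathcal{F}(\mathcal{A})/\Bbbk R(H)\to\Bbbk_{\hat1}$, sending the coset of the identity to $1$ and the cosets of all other faces to $0$, is a projective cover.
   Context: An essential central arrangement is a finite set $\mathcal{A}=\{H_1,\dots,H_n\}$ of linear hyperplanes $H_i=\ker f_i$ ($f_i$ linear forms) in $\mathbb{R}^d$ with $\bigcap H_i=\{0\}$. Let $L=\{0,+,-\}$ with $0$ an identity and $+x=+$, $-x=-$, and $L^n$ with componentwise product. Define $\theta(x)=(\mathrm{sgn} f_1(x),\dots,\mathrm{sgn} f_n(x))$; the face monoid $\mathcal{F}(\mathcal{A})=\theta(\mathbb{R}^d)$ is a submonoid of $L^n$ with identity $\theta(0)=(0,\dots,0)$. The intersection lattice consists of all intersections of hyperplanes of $\mathcal{A}$. A hyperplane $H=\ker f$ is generic with respect to $\mathcal{A}$ if it contains no element of the intersection lattice other than $\{0\}$. $\Bbbk_{\hat1}$ denotes the right module $\Bbbk$ on which the identity acts by $1$ and every other element of $\mathcal{F}(\mathcal{A})$ acts by $0$. A projective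 cover of a module $M$ is a surjective homomorphism from a finite-dimensional projective module $P$ onto $M$ whose kernel lies in the radical of $P$. *)

(* Defs.v *)
From HB Require Import structures.
From mathcomp Require Import all_boot all_order all_algebra.
From mathcomp Require Import finmap.
From mathcomp.classical Require Import boolp.
From mathcomp.reals Require Import reals.
From mathcomp.multinomials Require Import monalg.

Set Implicit Arguments.
Unset Strict Implicit.
Unset Printing Implicit Defensive.

Import Order.TTheory GRing.Theory Num.Theory.

Local Open Scope ring_scope.
Local Open Scope quotient_scope.

(* The monoid L = {0, +, -}. *)
Inductive sign := Zero | Pos | Neg.

Definition sign_to_option (s : sign) : option bool :=
  match s with Zero => None | Pos => Some true | Neg => Some false end.

Definition sign_of_option (o : option bool) : sign :=
  match o with None => Zero | Some true => Pos | Some false => Neg end.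

Lemma sign_to_optionK : cancel sign_to_option sign_of_option.
Proof. by case. Qed.

HB.instance Definition _ := Finite.copy sign (can_type sign_to_optionK).

Definition sign_mul (s t : sign) : sign := if s is Zero then t else s.

Lemma sign_mulA : associative sign_mul. Proof. by case. Qed.

Definition sgn (R : realType) (x : R) : sign :=
  if x == 0 then Zero else if 0 < x then Pos else Neg.

Section Arrangement.
Variables (R : realType) (d n : nat) (f : 'I_n -> 'Hom('rV[R]_d, R^o)).

(* Distinct indices give distinct hyperplanes, the arrangement being a set. *)
Definition essential_arrangement : Prop :=
  [/\ forall i, f i != 0,
      injective (fun i => lker (f i))
    & (\bigcap_(i < n) lker (f i))%VS = 0%VS].

(* The empty intersection is the whole space. *)
Definition in_intersection_lattice (X : {vspace 'rV[R]_d}) : Prop :=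
  exists S : {set 'I_n}, X = (\bigcap_(i in S) lker (f i))%VS.

Definition generic_hyperplane (h : 'Hom('rV[R]_d, R^o)) : Prop :=
  h != 0 /\
  forall X, in_intersection_lattice X -> (X <= lker h)%VS -> X = 0%VS.

Definition theta (x : 'rV[R]_d) : {ffun 'I_n -> sign} :=
  [ffun i => sgn (f i x : R)].

Record face := Face {
  face_val :> {ffun 'I_n -> sign};
  _ : `[< exists x, face_val = theta x >]
}.

HB.instance Definition _ := [isSub for face_val].
HB.instance Definition _ := [Finite of face by <:].

Lemma theta0 : theta 0 = [ffun=> Zero].
Proof. by apply/ffunP=> i; rewrite !ffunE linear0 /sgn eqxx. Qed.

Lemma theta_mul (x y : 'rV[R]_d) :
  exists z, [ffun i => sign_mul (theta x i) (theta y i)] = theta z.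
Proof.
(* z = x + e y with e > 0 small *)
suff [e [e0 He]] : exists e : R, 0 < e /\
    forall i, (f i x : R) != 0 -> e * `|f i y : R| < `|f i x : R|.
  exists (x + e *: y); apply/ffunP=> i; rewrite !ffunE.
  have -> : (f i (x + e *: y) : R) = (f i x : R) + e * (f i y : R).
    by rewrite linearD linearZ.
  have := He i; move: (f i x : R) (f i y : R) => a b.
  rewrite /sgn; have [->|a0] := eqVneq a 0.
    by move=> _; rewrite add0r mulf_eq0 (gt_eqF e0) (pmulr_rgt0 _ e0).
  move=> /(_ isT); rewrite -{1}(gtr0_norm e0) -normrM => Hlt.
  have -> : (a + e * b == 0) = false.
    apply/negP; rewrite addrC addr_eq0 => /eqP E.
    by move: Hlt; rewrite E normrN ltxx.
  have -> : (0 < a + e * b) = (0 < a).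
    have [ap|an|a00] := ltgtP 0 a; last by rewrite -a00 eqxx in a0.
    - move: Hlt; rewrite (gtr0_norm ap) ltr_norml => /andP[H _].
      by rewrite -ltrBlDl sub0r.
    - move: Hlt; rewrite (ltr0_norm an) ltr_norml opprK => /andP[_ H].
      by apply/negbTE; rewrite -leNgt -lerBrDl sub0r ltW.
  by case: ltP.
have ex_e (i : 'I_n) : exists e : R, 0 < e /\
    ((f i x : R) != 0 -> e * `|f i y : R| < `|f i x : R|).
  exists (if (f i x : R) == 0 then 1 else
    `|f i x : R| / (`|f i y : R| + 1)).
  have yp : 0 < `|f i y : R| + 1 by rewrite ltr_wpDl.
  case: eqP => [_|/eqP a0]; split=> //; first by rewrite divr_gt0 ?normr_gt0.
  by move=> _; rewrite mulrAC ltr_pdivrMr // ltr_pM2l ?normr_gt0 // ltrDl.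
have [es Hes] := fin_all_exists ex_e.
exists (\big[Order.min/1]_i es i); split.
  by apply: lt_bigmin => [|i _]; [exact: ltr01|exact: (Hes i).1].
move=> i ai; apply: le_lt_trans ((Hes i).2 ai).
by rewrite ler_wpM2r ?normr_ge0 // bigmin_le.
Qed.

Lemma face_one_subproof :
  `[< exists x, [ffun=> Zero] = theta x >].
Proof. by apply/asboolP; exists 0; rewrite theta0. Qed.

Definition face_one : face := Face face_one_subproof.

Lemma face_mul_subproof (s t : face) :
  `[< exists x, [ffun i => sign_mul (s i) (t i)] = theta x >].
Proof.
case: s t => [s hs] [t ht] /=.
move/asboolP: hs => [x ->]; move/asboolP: ht => [y ->].
exact/asboolP/theta_mul.
Qed.

Definition face_mul (s t : face) : face := Face (face_mul_subproof s t).

Lemma face_mulA : associative face_mul.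
Proof.
move=> s t u; apply/val_inj/ffunP=> i /=.
by rewrite !ffunE sign_mulA.
Qed.

Lemma face_mul1 : left_id face_one face_mul.
Proof. by move=> s; apply/val_inj/ffunP=> i /=; rewrite !ffunE. Qed.

Lemma face_mulr1 : right_id face_one face_mul.
Proof.
by move=> s; apply/val_inj/ffunP=> i /=; rewrite !ffunE; case: (face_val s i).
Qed.

Lemma face_unit (s t : face) :
  face_mul s t = face_one -> s = face_one /\ t = face_one.
Proof.
move=> /(congr1 face_val)/ffunP E.
split; apply/val_inj/ffunP=> i /=; have := E i; rewrite /= !ffunE.
  by case: (face_val s i).
by case: (face_val s i).
Qed.

(* [monomType] is the monoid structure over which [{malg K[M]}] is the monoid
   algebra; its last axiom (a product is 1 only if both factors are) holds for
   every face monoid. *)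
HB.instance Definition _ := Choice_isMonomialDef.Build face
  face_mulA face_mul1 face_mulr1 face_unit.

Definition visual_hemisphere (h : 'Hom('rV[R]_d, R^o)) : {set face} :=
  [set t : face | `[< exists x, 0 < (h x : R) /\ face_val t = theta x >]].

End Arrangement.

(* The subspace of the monoid algebra spanned by a set of monoid elements. *)
Definition malg_on (k : fieldType) (M : monomType) (X : {pred M}) :
  {pred {malg k[M]}} := [pred a | all (mem X) (msupp a)].
Arguments malg_on k {M} X.

(* Right modules over A are modules over the converse ring A^c, and A itself is
   the right module (A^c)^o, in which a *: u is the product u * a of A. *)
Definition right_ideal (A : nzRingType) (I : {pred A}) : Prop :=
  submod_closed (I : {pred (A^c)^o}).

Section Modules.
Variable A : nzRingType.

Definition projective (P : lmodType A) : Prop :=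
  forall (U V : lmodType A) (g : {linear U -> V}) (h : {linear P -> V}),
    (forall v, exists u, g u = v) ->
    exists l : {linear P -> U}, forall p, g (l p) = h p.

Definition maximal_submodule (V : lmodType A) (S : {pred V}) : Prop :=
  [/\ submod_closed S, exists v, v \notin S &
      forall T : {pred V}, submod_closed T -> {subset S <= T} ->
        (exists v, v \notin T) -> {subset T <= S}].

Definition in_radical (V : lmodType A) (v : V) : Prop :=
  forall S : {pred V}, maximal_submodule S -> v \in S.

Section Quotient.
Variables (V : lmodType A) (S : {pred V}).

Definition submodule_pred of submod_closed S : {pred V} := S.

Variable hS : submod_closed S.

HB.instance Definition _ :=
  GRing.isSubmodClosed.Build A V (submodule_pred hS) hS.

Definition quotient_module : Type := Quotient.quot (submodule_pred hS).

HB.instance Definition _ := GRing.Zmodule.on quotient_module.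

Definition coset (v : V) : quotient_module :=
  \pi_(Quotient.quot (submodule_pred hS)) v.

Lemma cosetP (u v : V) : reflect (coset u = coset v) (u - v \in S).
Proof.
have E := Quotient.idealrBE (submodule_pred hS) u v.
apply: (iffP idP) => H; first by apply/eqP; rewrite -E.
by apply: etrans E _; apply/eqP.
Qed.

Definition quotient_scale (a : A) (q : quotient_module) : quotient_module :=
  coset (a *: repr (q : Quotient.quot (submodule_pred hS))).

Lemma coset_ind (P : quotient_module -> Prop) :
  (forall v, P (coset v)) -> forall q, P q.
Proof. by move=> H q; rewrite -[q]reprK; apply: H. Qed.

Lemma coset_is_zmod_morphism : zmod_morphism coset.
Proof. by move=> u v; rewrite /coset raddfB. Qed.

HB.instance Definition _ := GRing.isZmodMorphism.Build V quotient_module coset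
  coset_is_zmod_morphism.

Lemma quotient_scaleE a v : quotient_scale a (coset v) = coset (a *: v).
Proof.
apply/cosetP; rewrite -scalerBr -[_ *: _]addr0.
by apply: hS.2 hS.1; apply/cosetP; exact: reprK.
Qed.

Lemma quotient_scaleA a b q :
  quotient_scale a (quotient_scale b q) = quotient_scale (a * b) q.
Proof. by elim/coset_ind: q => v; rewrite !quotient_scaleE scalerA. Qed.

Lemma quotient_scale1 : left_id 1 quotient_scale.
Proof. by elim/coset_ind => v; rewrite quotient_scaleE scale1r. Qed.

Lemma quotient_scaleDr : right_distributive quotient_scale +%R.
Proof.
move=> a; elim/coset_ind=> u; elim/coset_ind=> v.
by rewrite -raddfD !quotient_scaleE scalerDr raddfD.
Qed.

Lemma quotient_scaleDl q : {morph quotient_scale^~ q : a b / a + b}.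
Proof.
by move=> a b; elim/coset_ind: q => v; rewrite !quotient_scaleE scalerDl raddfD.
Qed.

HB.instance Definition _ := GRing.Zmodule_isLmodule.Build A quotient_module
  quotient_scaleA quotient_scale1 quotient_scaleDr quotient_scaleDl.

End Quotient.
End Modules.

Section ProjectiveCover.
Variables (k : fieldType) (A : lalgType k).

(* A right A-module is a k-space through k -> A. *)
Definition finite_dimensional (P : lmodType A^c) : Prop :=
  exists s : seq P, forall p : P, exists c : nat -> k,
    p = \sum_(i < size s) ((c i)%:A : A^c) *: s`_i.

Definition projective_cover (P M : lmodType A^c) (psi : {linear P -> M}) :
  Prop :=
  [/\ finite_dimensional P, projective P, forall m, exists p, psi p = m
    & forall p, psi p = 0 -> in_radical p].
End ProjectiveCover.

(* The right k M-module k on which 1 in M acts as the identity and every other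
   element of M as zero. *)
Definition unit_module (k : fieldType) (M : monomType) : Type := k.

Section UnitModule.
Variables (k : fieldType) (M : monomType).
Local Notation A := {malg k[M]}.

HB.instance Definition _ := GRing.Zmodule.on (unit_module k M).

Definition unit_scale (a : A^c) (c : unit_module k M) : unit_module k M :=
  (a : A)@_mone * (c : k).

Lemma unit_scaleA a b c : unit_scale a (unit_scale b c) = unit_scale (a * b) c.
Proof.
rewrite /unit_scale mulrA; congr (_ * _).
by rewrite mulrC -(rmorphM (mcoeff mone)).
Qed.

Lemma unit_scale1 : left_id 1 unit_scale.
Proof. by move=> c; rewrite /unit_scale mcoeff1 eqxx mul1r. Qed.

Lemma unit_scaleDr : right_distributive unit_scale +%R.
Proof. by move=> a b c; exact: mulrDr. Qed.

Lemma unit_scaleDl c : {morph unit_scale^~ c : a b / a + b}.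
Proof. by move=> a b; rewrite /unit_scale mcoeffD mulrDl. Qed.

HB.instance Definition _ := GRing.Zmodule_isLmodule.Build A^c
  (unit_module k M) unit_scaleA unit_scale1 unit_scaleDr unit_scaleDl.

Lemma unit_moduleE (m : M) (c : unit_module k M) :
  (<< m >> : A^c) *: c = if m == mone then c else 0.
Proof.
rewrite [LHS]/(unit_scale _ _) /unit_scale mcoeffU1.
by case: eqP; rewrite (mul1r, mul0r).
Qed.
End UnitModule.

(* Main.v *)
(* The span of the visual hemisphere R has a left identity g, so that it is g A
   for the idempotent g and A / g A is a direct summand of A, hence projective.
   To find g, regard R as a set of sign vectors.  It is closed under products
   and satisfies the elimination axiom: if x_i = + and y_i = -, some z has
   z_i = 0 and z_l = (x y)_l for every l at which x and y commute.  The span of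
   any such set has a two-sided identity, by induction on the number of
   coordinates: remove the coordinate i, and glue the identities a, b, c of the
   parts where it is +, -, 0 into 1 - (1 - c) (1 - a) (1 - b).

   For the radical, let t <> 1 be a face outside R.  By genericity the face
   opposite to t is a face s of R.  It has the same zeros as t, so that
   (t - s) w (t - s) = 0 for every w, and t is congruent to t - s modulo R. *)

Require Import Defs.
From HB Require Import structures.
From mathcomp Require Import all_boot all_order all_algebra.
From mathcomp Require Import finmap.
From mathcomp.classical Require Import boolp.
From mathcomp.reals Require Import reals.
From mathcomp.multinomials Require Import monalg.

Set Implicit Arguments.
Unset Strict Implicit.
Unset Printing Implicit Defensive.

Import Order.TTheory GRing.Theory Num.Theory.

Local Open Scope ring_scope.

(** * Identities of spans of sign vectors *)

Section Identity.
Variable A : nzRingType.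
Implicit Types X Y Z : {pred A}.

Definition identity_on X (e : A) : Prop :=
  [/\ e \in X, forall u, u \in X -> e * u = u & forall u, u \in X -> u * e = u].

Definition subtractive X : Prop := forall u v, u \in X -> v \in X -> u - v \in X.

Definition muls_into X Y Z : Prop :=
  forall u v, u \in X -> v \in Y -> u * v \in Z.

(** Both [a * c] and [c * a] lie in [X], so [a * c = a * c * a = c * a]. *)
Lemma identity_comm X Y a c : identity_on X a -> identity_on Y c ->
  muls_into X Y X -> muls_into Y X X -> GRing.comm a c.
Proof.
move=> [aX La Ra] [cY _ _] XY YX.
have [acX caX] : a * c \in X /\ c * a \in X by split; [apply: XY|apply: YX].
by rewrite /GRing.comm -[LHS]Ra // -mulrA La.
Qed.
End Identity.

(** * Gluing three partial identities *)

Section Glue.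
Variables (A : nzRingType) (a b c : A).
Hypotheses (ac : GRing.comm a c) (bc : GRing.comm b c).
Hypotheses (cab : c * (a * b) = a * b) (cba : c * (b * a) = b * a).

(** Equal to [1 - (1 - c) * (1 - a) * (1 - b)], because [1 - c] annihilates [a * b]; this form is
    symmetric in [a] and [b]. *)
Definition glue : A := 1 - (1 - c) * (1 - a - b).

Let glueC : (1 - c) * (1 - a - b) = (1 - a - b) * (1 - c).
Proof.
apply: commrB; first apply: commrB; first exact: commr1.
  by apply/commr_sym/commrB; [exact: commr1|].
by apply/commr_sym/commrB; [exact: commr1|].
Qed.

(** If [a * u = u], then [(1 - a - b) * u = - (b * a * u)], which [1 - c] kills since [c] fixes
    [b * a]; the case of [b] is symmetric. If [c * u = u], the factor [1 - c] is first moved to the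
    right. *)
Lemma glue_mull (u : A) : [\/ a * u = u, b * u = u | c * u = u] -> glue * u = u.
Proof.
have cK v : c * v = v -> (1 - c) * v = 0.
  by move=> cv; rewrite mulrBl mul1r cv subrr.
rewrite /glue mulrBl mul1r => H.
suff -> : (1 - c) * (1 - a - b) * u = 0 by rewrite subr0.
case: H => [au|bu|/cK cu]; last by rewrite glueC -mulrA cu mulr0.
- have E : (1 - a - b) * u = - (b * a * u).
    by rewrite !mulrBl mul1r au subrr sub0r -mulrA au.
  by rewrite -mulrA E mulrN mulrA cK ?mul0r ?oppr0.
- have E : (1 - a - b) * u = - (a * b * u).
    by rewrite !mulrBl mul1r bu addrAC subrr sub0r -mulrA bu.
  by rewrite -mulrA E mulrN mulrA cK ?mul0r ?oppr0.
Qed.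

Lemma glue_mulr (u : A) : [\/ u * a = u, u * b = u | u * c = u] -> u * glue = u.
Proof.
have Kc v : v * c = v -> v * (1 - c) = 0.
  by move=> cv; rewrite mulrBr mulr1 cv subrr.
have abc : a * b * c = a * b by rewrite -mulrA bc mulrA ac -mulrA cab.
have bac : b * a * c = b * a by rewrite -mulrA ac mulrA bc -mulrA cba.
rewrite /glue mulrBr mulr1 => H.
suff -> : u * ((1 - c) * (1 - a - b)) = 0 by rewrite subr0.
case: H => [ua|ub|/Kc uc]; last by rewrite mulrA uc mul0r.
- have E : u * (1 - a - b) = - (u * (a * b)).
    by rewrite !mulrBr mulr1 ua subrr sub0r mulrA ua.
  by rewrite glueC mulrA E mulNr -mulrA Kc ?mulr0 ?oppr0.
- have E : u * (1 - a - b) = - (u * (b * a)).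
    by rewrite !mulrBr mulr1 ub addrAC subrr sub0r mulrA ub.
  by rewrite glueC mulrA E mulNr -mulrA Kc ?mulr0 ?oppr0.
Qed.
End Glue.

(* [P], [N], [K] stand for the spans of the parts where the coordinate i is +, -,
   0, after erasing that coordinate; multiplying by [s] or [t] writes + or - there. *)
Section Halves.
Variables (A : nzRingType) (C P N K : {pred A}) (e a b c : A).
Hypotheses (eC : identity_on C e) (aP : identity_on P a)
  (bN : identity_on N b) (cK : identity_on K c).
Hypotheses (subP : subtractive P) (subN : subtractive N).
Hypotheses (PC : muls_into P C P) (NC : muls_into N C N)
  (KP : muls_into K P P) (KN : muls_into K N N).
Hypotheses (sub : [/\ {subset P <= C}, {subset N <= C} & {subset K <= C}])
  (cover : forall u, u \in C ->
     exists p n v, [/\ p \in P, n \in N, v \in K & u = p + n + v])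
  (PN : {subset [predI P & N] <= K})
  (absorb : forall r v, r \in K -> r * v * c = r * v).

Lemma halves_comm : GRing.comm a c /\ GRing.comm b c.
Proof.
have [sP sN sK] := sub.
by split; [apply: (identity_comm aP cK)|apply: (identity_comm bN cK)] => // u v
   uX /sK; [apply: PC|apply: NC].
Qed.

(** Split [u = p + n + r]. The factor [1 - a] kills [p]; it keeps [n] inside [N], where [1 - b]
    kills it; and [1 - c] kills every multiple of [r] by [absorb]. The other order exchanges the
    roles of [p] and [n]. *)
Let annihilate u : u \in C ->
  u * (1 - a) * (1 - b) * (1 - c) = 0 /\ u * (1 - b) * (1 - a) * (1 - c) = 0.
Proof.
have [sP sN sK] := sub; have [[aS La Ra] [bS Lb Rb]] := (aP, bN).
have D (v x : A) : x * v = x -> x * (1 - v) = 0.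
  by move=> E; rewrite mulrBr mulr1 E subrr.
case/cover=> [p [n [r [pP nN rK ->]]]].
have Dr v w : r * v * w * (1 - c) = 0 by apply: D; rewrite -(mulrA r) absorb.
rewrite !mulrDl !Dr !addr0 (D a p) ?Ra // (D b n) ?Rb // !mul0r addr0 add0r.
have nb : n * (1 - a) * b = n * (1 - a).
  by apply: Rb; rewrite mulrBr mulr1; apply: subN => //; apply: NC => //; apply: sP.
have pa : p * (1 - b) * a = p * (1 - b).
  by apply: Ra; rewrite mulrBr mulr1; apply: subP => //; apply: PC => //; apply: sN.
by rewrite (D _ _ nb) (D _ _ pa) !mul0r.
Qed.

(** The element [w = a * b * (1 - c)] equals [b * a * (1 - c)], so it lies in [P] and in [N], hence
    in [K]. There [w = w * c], and [(1 - c) * c = 0] forces [w = 0]. *)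
Lemma halves_mul : c * (a * b) = a * b /\ c * (b * a) = b * a.
Proof.
have [sP sN sK] := sub; have [ac bc] := halves_comm.
have [[eS Le Re] [aS La Ra] [bS Lb Rb] [cS Lc Rc]] := And4 eC aP bN cK.
have [aC bC cC] := And3 (sP _ aS) (sN _ bS) (sK _ cS).
have E u v : u \in C -> v \in C -> e * (1 - u) * (1 - v) = e - u - v + u * v.
  move=> uC vC; rewrite (mulrBr e) mulr1 Le // mulrBr mulr1 mulrBl Le // opprB.
  by rewrite [u * v - v]addrC addrA.
(* [e] stands in for 1, which need not lie in [C]; the two orders of the factors differ by
   [a * b - b * a]. *)
have [E1 E2] := annihilate eS.
have w_eq : a * b * (1 - c) = b * a * (1 - c).
  apply/eqP; rewrite -subr_eq0 -mulrBl.
  have -> : a * b - b * a = e * (1 - a) * (1 - b) - e * (1 - b) * (1 - a).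
    by rewrite !E // opprD (addrAC e) addrACA subrr add0r.
  by rewrite mulrBl E1 E2 subrr.
have wP : a * b * (1 - c) \in P.
  by rewrite mulrBr mulr1; apply: subP; [|apply: PC => //]; apply: PC.
have wN : a * b * (1 - c) \in N.
  by rewrite w_eq mulrBr mulr1; apply: subN; [|apply: NC => //]; apply: NC.
have w0 : a * b * (1 - c) = 0.
  have wK : a * b * (1 - c) \in K by apply: PN; rewrite inE wP wN.
  by rewrite -(Rc _ wK) -mulrA mulrBl mul1r Lc // subrr mulr0.
have cK' u : u * (1 - c) = 0 -> u * c = u.
  by move/eqP; rewrite mulrBr mulr1 subr_eq0 => /eqP.
rewrite !mulrA -ac -bc -!mulrA -ac -bc !mulrA.
by split; apply: cK'; rewrite -?w_eq.
Qed.

Variables s t : A.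
Hypotheses (ss : s * s = s) (st : s * t = s) (ts : t * s = t) (tt : t * t = t).
Hypotheses (sC : forall u, u \in C -> GRing.comm s u)
  (tC : forall u, u \in C -> GRing.comm t u).

(** As [s * t = s], [t * s = t] and both commute with [C], the products of [s * a] and [t * b] are
    [s * (a * b)] and [t * (b * a)], which [c] fixes by [halves_mul]. So [s * a], [t * b] and [c]
    can be glued. *)
Lemma halves_glue : exists g, [/\
    exists p n, [/\ p \in P, n \in N & g = c + s * p + t * n],
    forall u, u \in P -> g * (s * u) = s * u /\ s * u * g = s * u,
    forall u, u \in N -> g * (t * u) = t * u /\ t * u * g = t * u
  & forall u, u \in K -> g * u = u /\ u * g = u].
Proof.
have [sP sN sK] := sub; have [ac bc] := halves_comm.
have [[aS La Ra] [bS Lb Rb] [cS Lc Rc]] := And3 aP bN cK.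
have [aC bC cC] := And3 (sP _ aS) (sN _ bS) (sK _ cS).
have M (x y u v : A) : x * y = x -> GRing.comm y u -> x * u * (y * v) = x * (u * v).
  by move=> xy yu; rewrite !mulrA -(mulrA x) -yu mulrA xy.
have Mc x u : GRing.comm x c -> GRing.comm u c -> GRing.comm (x * u) c.
  by move=> xc uc; apply/commr_sym/commrM; apply/commr_sym.
have gac := Mc _ _ (sC cC) ac; have gbc := Mc _ _ (tC cC) bc.
have [cab cba] := halves_mul.
have cM x u : GRing.comm x c -> c * u = u -> c * (x * u) = x * u.
  by move=> xc cu; rewrite mulrA -xc -mulrA cu.
have gab : c * (s * a * (t * b)) = s * a * (t * b).
  by rewrite (M _ _ _ _ st (tC aC)) cM //; apply: sC.
have gba : c * (t * b * (s * a)) = t * b * (s * a).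
  by rewrite (M _ _ _ _ ts (sC bC)) cM //; apply: tC.
exists (glue (s * a) (t * b) c); split.
(* Expanding [glue] gives [c + (1 - c) * s * a + (1 - c) * t * b]; this form later shows that [g]
   lies in the span of the original set. *)
- exists (a - c * a), (b - c * b); split.
  + by apply: subP => //; apply: KP.
  + by apply: subN => //; apply: KN.
  + have Mz x v : GRing.comm x c -> x * (v - c * v) = (1 - c) * (x * v).
      by move=> xc; rewrite mulrBr mulrBl mul1r !mulrA xc.
    rewrite !Mz; [|exact: tC|exact: sC].
    rewrite /glue -addrA -opprD mulrBr mulr1 opprB addrCA [LHS]addrC mulrDr.
    by rewrite opprB [1 + (c - 1)]addrC subrK addrA.
- move=> u uP; split.
  + by apply: glue_mull => //; apply: Or31; rewrite (M _ _ _ _ ss (sC aC)) La.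
  + by apply: glue_mulr => //; apply: Or31; rewrite (M _ _ _ _ ss (sC (sP _ uP))) Ra.
- move=> u uN; split.
  + by apply: glue_mull => //; apply: Or32; rewrite (M _ _ _ _ tt (tC bC)) Lb.
  + by apply: glue_mulr => //; apply: Or32; rewrite (M _ _ _ _ tt (tC (sN _ uN))) Rb.
- move=> u uK; split.
  + by apply: glue_mull => //; apply: Or33; rewrite Lc.
  + by apply: glue_mulr => //; apply: Or33; rewrite Rc.
Qed.

End Halves.

(** * Spans of subsets of a monoid *)

Section Span.
Variables (k : fieldType) (M : monomType).
Local Notation A := {malg k[M]}.
Implicit Types (X Y Z : {pred M}) (a b e u v : A).

Lemma malg_onP X a :
  reflect (forall m, a@_m != 0 -> m \in X) (a \in malg_on k X).
Proof.
apply: (iffP allP) => H m; first by rewrite mcoeff_neq0; exact: H.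
by rewrite -mcoeff_neq0; exact: H.
Qed.

Lemma malg_on0 X : 0 \in malg_on k X.
Proof. by apply/malg_onP => m; rewrite mcoeff0 eqxx. Qed.

Lemma malg_onN X a : a \in malg_on k X -> - a \in malg_on k X.
Proof.
by move=> /malg_onP H; apply/malg_onP=> m; rewrite mcoeffN oppr_eq0; apply: H.
Qed.

Lemma malg_onD X a b :
  a \in malg_on k X -> b \in malg_on k X -> a + b \in malg_on k X.
Proof.
move=> /malg_onP Ha /malg_onP Hb; apply/malg_onP=> m.
rewrite mcoeffD; have [->|am _] := eqVneq a@_m 0; last exact: Ha.
by rewrite add0r; apply: Hb.
Qed.

Lemma malg_onB X a b :
  a \in malg_on k X -> b \in malg_on k X -> a - b \in malg_on k X.
Proof. by move=> Ha Hb; apply: malg_onD => //; apply: malg_onN. Qed.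

Lemma malg_onU X (c : k) (m : M) : m \in X -> << c *g m >> \in malg_on k X.
Proof.
move=> mX; apply/malg_onP=> m'; rewrite mcoeffU.
by case: (m =P m') => [<-//|_]; rewrite mulr0n eqxx.
Qed.

Lemma malg_on_ind X (P : A -> Prop) :
  P 0 -> (forall a b, P a -> P b -> P (a + b)) ->
  (forall c m, m \in X -> P << c *g m >>) ->
  forall a, a \in malg_on k X -> P a.
Proof.
move=> P0 PD PU a /allP aX; rewrite [a]monalgE big_seq.
by elim/big_rec: _ => // m b /aX mX; apply: PD; apply: PU.
Qed.

Lemma malg_onS X Y a :
  {subset X <= Y} -> a \in malg_on k X -> a \in malg_on k Y.
Proof. by move=> XY /malg_onP H; apply/malg_onP=> m /H /XY. Qed.

Lemma malg_onI X Y a :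
  a \in malg_on k X -> a \in malg_on k Y -> a \in malg_on k [predI X & Y].
Proof.
by move=> /malg_onP HX /malg_onP HY; apply/malg_onP=> m am; rewrite inE HX ?HY.
Qed.

Lemma malg_onM X Y Z a b :
  (forall x y, x \in X -> y \in Y -> mmul x y \in Z) ->
  a \in malg_on k X -> b \in malg_on k Y -> a * b \in malg_on k Z.
Proof.
move=> XYZ aX bY; elim/malg_on_ind: a / aX => [|u v Hu Hv|c x xX].
- by rewrite mul0r malg_on0.
- by rewrite mulrDl malg_onD.
elim/malg_on_ind: b / bY => [|u v Hu Hv|c' y yY].
- by rewrite mulr0 malg_on0.
- by rewrite mulrDr malg_onD.
by rewrite malgM_def fgmulUU malg_onU ?XYZ.
Qed.

Lemma malg_mulU (c c' : k) (x y : M) :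
  << c *g x >> * << c' *g y >> = << c * c' *g mmul x y >> :> A.
Proof. by rewrite malgM_def fgmulUU. Qed.

Lemma malgUU (x y : M) : << x >> * << y >> = << mmul x y >> :> A.
Proof. by rewrite malgM_def fgmulUU mulr1. Qed.

Lemma malgU_mulC (c : k) (x : M) :
  << c *g x >> = << c *g mone >> * << x >> :> A.
Proof. by rewrite malgM_def fgmulUU mulr1 mul1m. Qed.

Lemma malgU_Cmul (c : k) (x : M) :
  << c *g x >> = << x >> * << c *g mone >> :> A.
Proof. by rewrite malgM_def fgmulUU mul1r mulm1. Qed.

Lemma malg_on_mulr X u v b :
  (forall x, x \in X -> u * << x >> = v * << x >>) ->
  b \in malg_on k X -> u * b = v * b.
Proof.
move=> H; elim/malg_on_ind: b / => [|b b' E E'|c x xX].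
- by rewrite !mulr0.
- by rewrite !mulrDr E E'.
by rewrite malgU_Cmul !mulrA H.
Qed.

Lemma malg_on_mull X u v b :
  (forall x, x \in X -> << x >> * u = << x >> * v) ->
  b \in malg_on k X -> b * u = b * v.
Proof.
move=> H; elim/malg_on_ind: b / => [|b b' E E'|c x xX].
- by rewrite !mul0r.
- by rewrite !mulrDl E E'.
by rewrite malgU_mulC -!mulrA H.
Qed.

Lemma identity_on_malg X e : e \in malg_on k X ->
  (forall x, x \in X -> e * << x >> = << x >>) ->
  (forall x, x \in X -> << x >> * e = << x >>) -> identity_on (malg_on k X) e.
Proof.
move=> eX L R; split=> // u uX.
  by rewrite -[RHS]mul1r; apply: malg_on_mulr uX => x xX; rewrite mul1r L.
by rewrite -[RHS]mulr1; apply: malg_on_mull uX => x xX; rewrite mulr1 R.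
Qed.

End Span.

(** * Sets of sign vectors closed under products and elimination *)

Section SignVectors.
Variables (k : fieldType) (I : finType).

(** All sign vectors, realizable or not: erasing a coordinate of a face need not give a face of the
    same arrangement. *)
Definition signvec := {ffun I -> sign}.

HB.instance Definition _ := Finite.on signvec.

Implicit Types (x y z : signvec) (U : {set signvec}).

Definition signvec_one : signvec := [ffun=> Zero].
Definition signvec_mul x y : signvec := [ffun i => sign_mul (x i) (y i)].

Lemma signvec_mulA : associative signvec_mul.
Proof. by move=> x y z; apply/ffunP=> i; rewrite !ffunE sign_mulA. Qed.

Lemma signvec_mul1x : left_id signvec_one signvec_mul.
Proof. by move=> x; apply/ffunP=> i; rewrite !ffunE. Qed.

Lemma signvec_mulx1 : right_id signvec_one signvec_mul.
Proof. by move=> x; apply/ffunP=> i; rewrite !ffunE; case: (x i). Qed.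

Lemma signvec_unit x y :
  signvec_mul x y = signvec_one -> x = signvec_one /\ y = signvec_one.
Proof.
move=> /ffunP E; split; apply/ffunP=> i; have := E i; rewrite !ffunE;
  by case: (x i).
Qed.

HB.instance Definition _ := Choice_isMonomialDef.Build signvec
  signvec_mulA signvec_mul1x signvec_mulx1 signvec_unit.

Local Notation "x ** y" := (mmul x y) (at level 40, left associativity).
Local Notation A := {malg k[signvec]}.

Lemma signvecE x y i : (x ** y) i = sign_mul (x i) (y i).
Proof. by rewrite ffunE. Qed.

(** The defining identity of left regular bands. *)
Lemma signvec_lrb x y : x ** y ** x = x ** y.
Proof. by apply/ffunP=> i; rewrite !signvecE; case: (x i) (y i) => [] []. Qed.

Definition product_closed (U : {set signvec}) : Prop :=
  {in U &, forall x y, x ** y \in U}.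

Definition elimination (U : {set signvec}) : Prop :=
  forall x y j, x \in U -> y \in U -> x j = Pos -> y j = Neg ->
  exists2 z, z \in U & z j = Zero /\
    forall l, sign_mul (x l) (y l) = sign_mul (y l) (x l) ->
      z l = sign_mul (x l) (y l).

(** For monomials [x] in [K] and any [y], [x ** y = x ** y ** x], and the last factor [x] absorbs
    [c]. *)
Lemma identity_absorb (K : {set signvec}) (c : A) :
  identity_on (malg_on k K) c ->
  forall r v, r \in malg_on k K -> r * v * c = r * v.
Proof.
move=> [_ _ Rc] r v rK; elim/malg_on_ind: r / rK => [|r r' E E'|t x xK].
- by rewrite !mul0r.
- by rewrite !mulrDl E E'.
have : v \in malg_on k predT by apply/malg_onP.
elim/malg_on_ind: v / => [|u u' E E'|t' y _].
- by rewrite mulr0 mul0r.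
- by rewrite mulrDr mulrDl E E'.
have -> : << t *g x >> * << t' *g y >> = << t * t' *g x ** y >> * << x >> :> A.
  by rewrite !malgM_def !fgmulUU mulr1 signvec_lrb.
by rewrite -mulrA (Rc _ (malg_onU 1 xK)).
Qed.

Definition part (i : I) s U : {set signvec} := [set x in U | x i == s].

Definition erase (i : I) x : signvec := [ffun j => if j == i then Zero else x j].
Definition only (i : I) (s : sign) : signvec :=
  [ffun j => if j == i then s else Zero].

Lemma only_erase i s x : x i = s -> only i s ** erase i x = x.
Proof.
move=> xi; apply/ffunP=> j; rewrite signvecE !ffunE.
by case: eqP => [->|_] //; rewrite xi; case: s xi.
Qed.

Lemma erase_id i x : x i = Zero -> erase i x = x.
Proof. by move=> xi; apply/ffunP=> j; rewrite ffunE; case: eqP => [->|]. Qed.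

Lemma onlyC i s x : x i = Zero -> only i s ** x = x ** only i s.
Proof.
move=> xi; apply/ffunP=> j; rewrite !signvecE !ffunE.
by case: eqP => [->|_]; rewrite ?xi; [case: s|case: (x j)].
Qed.

Lemma only_mul i s t : s != Zero -> only i s ** only i t = only i s.
Proof.
by move=> s0; apply/ffunP=> j; rewrite signvecE !ffunE; case: eqP; case: s s0.
Qed.

Lemma eraseM i x y : erase i (x ** y) = erase i x ** erase i y.
Proof. by apply/ffunP=> j; rewrite !(signvecE, ffunE); case: ifP. Qed.

Lemma erase_closed i U : product_closed U -> product_closed (erase i @: U).
Proof.
move=> H _ _ /imsetP[x xU ->] /imsetP[y yU ->].
by rewrite -eraseM imset_f // H.
Qed.

Lemma erase_elimination i U : elimination U -> elimination (erase i @: U).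
Proof.
move=> H _ _ j /imsetP[x xU ->] /imsetP[y yU ->].
rewrite !ffunE; case: eqP => // ji xj yj.
have [z zU [zj Hz]] := H x y j xU yU xj yj.
exists (erase i z); first exact: imset_f.
split=> [|l]; rewrite !ffunE; first by case: eqP.
by case: eqP => // _; exact: Hz.
Qed.

Lemma part_closed i s U : product_closed U -> product_closed (part i s U).
Proof.
move=> H x y; rewrite !inE => /andP[xU /eqP xi] /andP[yU /eqP yi].
by rewrite H //= signvecE xi yi; case: s {xi yi}.
Qed.

(** The two vectors agree at [i], hence commute there, so the eliminated vector keeps the value
    [s]. *)
Lemma part_elimination i s U : elimination U -> elimination (part i s U).
Proof.
move=> H x y j; rewrite !inE => /andP[xU /eqP xi] /andP[yU /eqP yi] xj yj.
have [z zU [zj Hz]] := H x y j xU yU xj yj.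
exists z; last by split.
by rewrite inE zU Hz xi yi //; case: s {xi yi}.
Qed.

Lemma only_comm i s v : v \in malg_on k [pred x : signvec | x i == Zero] ->
  GRing.comm << only i s >> v.
Proof.
elim/malg_on_ind: v / => [|u v Hu Hv|t x /eqP xi].
- exact: commr0.
- exact: commrD.
by rewrite /GRing.comm !malgM_def !fgmulUU mul1r mulr1 onlyC.
Qed.

Lemma erase_part_sub i s U : {subset erase i @: part i s U <= erase i @: U}.
Proof. by apply/subsetP/imsetS/subsetP => x; rewrite inE => /andP[]. Qed.

Lemma erase_partM i s U x y : product_closed U -> s != Zero ->
  x \in erase i @: part i s U -> y \in erase i @: U ->
  x ** y \in erase i @: part i s U.
Proof.
move=> clU s0 /imsetP[x'].
rewrite inE => /andP[x'U /eqP x'i] -> /imsetP[y' y'U ->].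
by rewrite -eraseM imset_f // inE clU //= signvecE x'i; case: s s0 {x'i}.
Qed.

Lemma zero_partM i s U x y : product_closed U ->
  x \in erase i @: part i Zero U -> y \in erase i @: part i s U ->
  x ** y \in erase i @: part i s U.
Proof.
move=> clU /imsetP[x']; rewrite inE => /andP[x'U /eqP x'i] -> /imsetP[y'].
rewrite inE => /andP[y'U /eqP y'i] ->.
by rewrite -eraseM imset_f // inE clU //= signvecE x'i y'i.
Qed.

Lemma part_cover i U x : x \in erase i @: U -> exists s, x \in erase i @: part i s U.
Proof.
by move=> /imsetP[y yU ->]; exists (y i); rewrite imset_f // inE yU eqxx.
Qed.

(** Two vectors with opposite signs at [i] and equal elsewhere commute off [i]; eliminating [i]
    leaves their common values and puts 0 at [i]. *)
Lemma part_cap i U x : elimination U -> x \in erase i @: part i Pos U ->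
  x \in erase i @: part i Neg U -> x \in erase i @: part i Zero U.
Proof.
move=> elU /imsetP[y]; rewrite inE => /andP[yU /eqP yi] -> /imsetP[z].
rewrite inE => /andP[zU /eqP zi] yz.
have [w wU [wi Hw]] := elU y z i yU zU yi zi.
apply/imsetP; exists w; first by rewrite inE wU wi /=.
apply/ffunP=> j; rewrite !ffunE; case: eqP => // ji.
have yzj : y j = z j by move/ffunP/(_ j): yz; rewrite !ffunE; case: eqP.
by rewrite Hw yzj //; case: (z j).
Qed.

Lemma span_cover i U (u : A) : u \in malg_on k (erase i @: U) ->
  exists p n v, [/\ p \in malg_on k (erase i @: part i Pos U),
    n \in malg_on k (erase i @: part i Neg U),
    v \in malg_on k (erase i @: part i Zero U) & u = p + n + v].
Proof.
elim/malg_on_ind: u / => [|u v|t x /part_cover[s xs]].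
- by exists 0, 0, 0; rewrite !malg_on0 !addr0.
- move=> [p [n [r [pP nN rK ->]]]] [p' [n' [r' [pP' nN' rK' ->]]]].
  exists (p + p'), (n + n'), (r + r').
  split; [exact: malg_onD|exact: malg_onD|exact: malg_onD|].
  by rewrite addrACA (addrACA p).
case: s xs => xs.
- by exists 0, 0, << t *g x >>; rewrite !malg_on0 !add0r;
    split=> //; apply: malg_onU.
- by exists << t *g x >>, 0, 0; rewrite !malg_on0 !addr0;
    split=> //; apply: malg_onU.
- by exists 0, << t *g x >>, 0; rewrite !malg_on0 addr0 add0r;
    split=> //; apply: malg_onU.
Qed.

Lemma part_identity i U (e a b c : A) : product_closed U -> elimination U ->
  identity_on (malg_on k (erase i @: U)) e ->
  identity_on (malg_on k (erase i @: part i Pos U)) a ->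
  identity_on (malg_on k (erase i @: part i Neg U)) b ->
  identity_on (malg_on k (erase i @: part i Zero U)) c ->
  exists g : A, identity_on (malg_on k U) g.
Proof.
move=> clU elU eC aP bN cK.
have sub s : {subset malg_on k (erase i @: part i s U) <= malg_on k (erase i @: U)}.
  by move=> u; apply: malg_onS; exact: erase_part_sub.
have comm s u : u \in malg_on k (erase i @: U) -> GRing.comm << only i s >> u.
  move=> uC; apply: only_comm; apply: malg_onS uC => _ /imsetP[x _ ->].
  by rewrite inE ffunE eqxx.
have only_part s u : u \in malg_on k (erase i @: part i s U) ->
    << only i s >> * u \in malg_on k U.
  apply: (@malg_onM _ _ (pred1 (only i s)));
    last by apply: malg_onU; rewrite inE.
  move=> _ y /eqP -> /imsetP[x]; rewrite inE => /andP[xU /eqP xi] ->.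
  by rewrite only_erase.
have idem s t : s != Zero -> << only i s >> * << only i t >> = << only i s >> :> A.
  by move=> s0; rewrite malgUU only_mul.
have [g [[p [n [pP nN gE]]] gP gN gK]] : exists g : A, [/\
    exists p n, [/\ p \in malg_on k (erase i @: part i Pos U),
      n \in malg_on k (erase i @: part i Neg U)
      & g = c + << only i Pos >> * p + << only i Neg >> * n],
    forall u, u \in malg_on k (erase i @: part i Pos U) ->
      g * (<< only i Pos >> * u) = << only i Pos >> * u /\
      << only i Pos >> * u * g = << only i Pos >> * u,
    forall u, u \in malg_on k (erase i @: part i Neg U) ->
      g * (<< only i Neg >> * u) = << only i Neg >> * u /\
      << only i Neg >> * u * g = << only i Neg >> * u
  & forall u, u \in malg_on k (erase i @: part i Zero U) -> g * u = u /\ u * g = u].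
  apply: (halves_glue eC aP bN cK).
  - exact: malg_onB.
  - exact: malg_onB.
  - by move=> u v; apply: malg_onM => x y; apply: erase_partM.
  - by move=> u v; apply: malg_onM => x y; apply: erase_partM.
  - by move=> u v; apply: malg_onM => x y; apply: zero_partM.
  - by move=> u v; apply: malg_onM => x y; apply: zero_partM.
  - by split; apply: sub.
  - exact: span_cover.
  - move=> u /andP[uP uN]; apply: malg_onS (malg_onI uP uN) => x /andP[xP xN].
    exact: part_cap xP xN.
  - exact: identity_absorb.
  - exact: idem.
  - exact: idem.
  - exact: idem.
  - exact: idem.
  - exact: comm.
  - exact: comm.
(* The sign of [x] at [i] selects the clause for [g]; when it is 0, erasing changes nothing. *)
have gU x : x \in U -> g * << x >> = << x >> /\ << x >> * g = << x >>.
  move=> xU.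
  have xS s : x i = s -> << erase i x >> \in malg_on k (erase i @: part i s U).
    by move=> xi; apply: malg_onU; apply: imset_f; rewrite inE xU xi eqxx.
  have xE s : x i = s -> << x >> = << only i s >> * << erase i x >> :> A.
    by move=> xi; rewrite malgUU only_erase.
  case xi: (x i).
  - by have := gK _ (xS _ xi); rewrite erase_id.
  - by have := gP _ (xS _ xi); rewrite -(xE _ xi).
  - by have := gN _ (xS _ xi); rewrite -(xE _ xi).
exists g; apply: identity_on_malg => [|x /gU[]//|x /gU[]//].
rewrite gE; apply: malg_onD; last exact: only_part.
apply: malg_onD; last exact: only_part.
have [cS _ _] := cK; apply: malg_onS cS => y /imsetP[x].
by rewrite inE => /andP[xU /eqP xi] ->; rewrite erase_id.
Qed.

Theorem span_identity_exists (U : {set signvec}) :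
  product_closed U -> elimination U -> exists e : A, identity_on (malg_on k U) e.
Proof.
(* The induction runs over a list containing all supports: erasing a coordinate shortens the list
   while the index type stays fixed. *)
have [s] : exists s : seq I, forall x, x \in U -> forall i, x i != Zero -> i \in s.
  by exists (enum I) => x _ i; rewrite mem_enum.
elim: s => [|i s IHs] in U * => [H _ _|Hs clU elU].
  (* With no coordinate left, [U] is empty, with identity 0, or consists of the neutral vector
     alone, with identity 1. *)
  have U1 x : x \in U -> x = mone.
    move=> xU; apply/ffunP=> i; rewrite ffunE.
    by apply/eqP/negPn/negP => /(H x xU).
  have [E|[x xU]] := set_0Vmem U.
    exists 0; apply: identity_on_malg => [|x|x]; rewrite ?E ?inE //.
    exact: malg_on0.
  exists << mone >>; apply: identity_on_malg => [|y _|y _].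
  - by apply: malg_onU; rewrite -(U1 x).
  - by rewrite malgUU mul1m.
  - by rewrite malgUU mulm1.
have IH (W : {set signvec}) : {subset W <= U} -> product_closed W ->
    elimination W -> exists e : A, identity_on (malg_on k (erase i @: W)) e.
  move=> WU clW elW; apply: IHs; [|exact: erase_closed|exact: erase_elimination].
  move=> _ /imsetP[x /WU xU ->] j; rewrite ffunE; case: (j =P i) => [_|ji xj].
    by rewrite eqxx.
  by have := Hs x xU j xj; rewrite inE => /orP[/eqP|].
have IHpart t : exists e : A, identity_on (malg_on k (erase i @: part i t U)) e.
  apply: IH; [|exact: part_closed|exact: part_elimination].
  by move=> x; rewrite inE => /andP[].
have [e eC] := IH U (fun _ => id) clU elU.
have [[a aP] [b bN] [c cK]] := And3 (IHpart Pos) (IHpart Neg) (IHpart Zero).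
exact: part_identity clU elU eC aP bN cK.
Qed.

End SignVectors.

(** * The visual hemisphere *)

Section Sgn.
Variable R : realType.
Implicit Types u v : R.

Lemma sgn0 : sgn (0 : R) = Zero.
Proof. by rewrite /sgn eqxx. Qed.

Lemma sgn_pos u : 0 < u -> sgn u = Pos.
Proof. by move=> u0; rewrite /sgn gt_eqF // u0. Qed.

Lemma sgn_neg u : u < 0 -> sgn u = Neg.
Proof. by move=> u0; rewrite /sgn lt_eqF // lt_gtF. Qed.

Variant sgn_spec u : sign -> Prop :=
  | SgnPos of 0 < u : sgn_spec u Pos
  | SgnNeg of u < 0 : sgn_spec u Neg
  | SgnZero of u = 0 : sgn_spec u Zero.

Lemma sgnP u : sgn_spec u (sgn u).
Proof.
have [u0|u0|<-] := ltgtP 0 u.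
- by rewrite sgn_pos //; constructor.
- by rewrite sgn_neg //; constructor.
- by rewrite sgn0; constructor.
Qed.

Lemma sgnN u :
  sgn (- u) = match sgn u with Zero => Zero | Pos => Neg | Neg => Pos end.
Proof.
case: (sgnP u) => [u0|u0|->].
- by rewrite sgn_neg // oppr_lt0.
- by rewrite sgn_pos // oppr_gt0.
- by rewrite oppr0 sgn0.
Qed.

(** Two signs commute exactly when they are not opposite, and then a positive combination has no
    cancellation. *)
Lemma sgn_comb (a b : R) u v : 0 < a -> 0 < b ->
  sign_mul (sgn u) (sgn v) = sign_mul (sgn v) (sgn u) ->
  sgn (a * u + b * v) = sign_mul (sgn u) (sgn v).
Proof.
move=> a0 b0; case: (sgnP u) => [u0|u0|->]; case: (sgnP v) => [v0|v0|->] //= _;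
  rewrite ?mulr0 ?addr0 ?add0r.
- by rewrite sgn_pos // addr_gt0 // mulr_gt0.
- by rewrite sgn_pos // mulr_gt0.
- by rewrite sgn_neg // -oppr_gt0 opprD addr_gt0 // -mulrN mulr_gt0 // oppr_gt0.
- by rewrite sgn_neg // pmulr_rlt0.
- by rewrite sgn_pos // mulr_gt0.
- by rewrite sgn_neg // pmulr_rlt0.
- exact: sgn0.
Qed.
End Sgn.

Lemma sandwich_sub (A : nzRingType) (s t w : A) :
  s * w * s = s * w -> s * w * t = s * w -> t * w * s = t * w ->
  t * w * t = t * w -> (s - t) * w * (s - t) = 0.
Proof. by move=> ss st ts tt; rewrite mulrBr !mulrBl ss st ts tt subrr. Qed.

(** * Faces, sign vectors and opposites *)

Section Hemisphere.
Variables (R : realType) (k : fieldType) (d n : nat).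
Variables (f : 'I_n -> 'Hom('rV[R]_d, R^o)) (h : 'Hom('rV[R]_d, R^o)).
Local Notation RH := (visual_hemisphere f h).

Lemma hemisphereP (t : face f) :
  reflect (exists x, 0 < (h x : R) /\ face_val t = theta f x) (t \in RH).
Proof. by rewrite inE; exact: asboolP. Qed.

Lemma faceP (t : face f) : exists x, face_val t = theta f x.
Proof. by case: t => t /= /asboolP. Qed.

(* Apply [theta_mul] to the arrangement enlarged by [h]. *)
Lemma theta_mul_ext (x y : 'rV[R]_d) : exists z,
  sgn (h z : R) = sign_mul (sgn (h x : R)) (sgn (h y : R)) /\
  [ffun i => sign_mul (theta f x i) (theta f y i)] = theta f z.
Proof.
have [z /ffunP E] := theta_mul (fun j : 'I_n.+1 => oapp f h (unlift ord0 j)) x y.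
exists z; split.
  by have := E ord0; rewrite !ffunE unlift_none /= => ->.
by apply/ffunP=> i; have := E (lift ord0 i); rewrite !ffunE liftK.
Qed.

(** With [h] adjoined to the arrangement, a product has sign + at [h] as soon as its left factor
    has. *)
Lemma hemisphereM (s t : face f) : s \in RH -> mmul s t \in RH.
Proof.
move=> /hemisphereP[x [hx sx]]; have [y ty] := faceP t.
have [z [hz zE]] := theta_mul_ext x y.
apply/hemisphereP; exists z; split.
  by move: hz; rewrite (sgn_pos hx) /=; case: (sgnP (h z : R)).
by rewrite -zE -sx -ty.
Qed.

(** A point with all signs zero lies on every hyperplane, hence is 0 by essentiality, and [h]
    vanishes there. *)
Lemma one_notin_hemisphere : essential_arrangement f -> mone \notin RH.
Proof.
move=> [_ _ ess]; apply/negP => /hemisphereP[x [hx /ffunP x0]].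
suff x00 : x = 0 by move: hx; rewrite x00 linear0 ltxx.
apply/eqP; rewrite -memv0 -ess memvE; apply/subv_bigcapP=> i _.
rewrite -memvE memv_ker; have := x0 i; rewrite !ffunE.
by case: (sgnP (f i x : R)) => // ->.
Qed.

Definition hemisphere_signs : {set signvec 'I_n} :=
  [set (face_val t : signvec 'I_n) | t in RH].

Lemma hemisphere_closed : product_closed hemisphere_signs.
Proof.
move=> _ _ /imsetP[s sR ->] /imsetP[t _ ->].
apply/imsetP; exists (mmul s t); first exact: hemisphereM.
by apply/ffunP=> i; rewrite !ffunE.
Qed.

Lemma hemisphere_elimination : elimination hemisphere_signs.
Proof.
move=> s' t' j /imsetP[s /hemisphereP[x [hx sx]] ->].
move=> /imsetP[t /hemisphereP[y [hy ty]] ->].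
rewrite sx ty !ffunE.
case: sgnP => // fx _; case: sgnP => // fy _.
(* The coefficients are positive and chosen so that [f j] vanishes at [z]; positivity also gives
   [h z > 0]. *)
pose z := (- f j y : R) *: x + (f j x : R) *: y.
have fz i : f i z = (- f j y : R) * (f i x : R) + (f j x : R) * (f i y : R) :> R.
  by rewrite linearD !linearZ.
have Hz : `[< exists z', theta f z = theta f z' >] by apply/asboolP; exists z.
exists (face_val (Face Hz)).
  apply/imset_f/hemisphereP; exists z; split=> //.
  rewrite linearD !linearZ /=; apply: addr_gt0; apply: mulr_gt0 => //.
  by rewrite oppr_gt0.
split=> [|l]; first by rewrite ffunE fz mulrC mulrN addNr sgn0.
rewrite !ffunE fz => E; apply: sgn_comb => //.
by rewrite oppr_gt0.
Qed.

Definition push : {malg k[face f]} -> {malg k[signvec 'I_n]} :=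
  locked (mmap malgC (fun t => << (face_val t : signvec 'I_n) >>)).

Lemma pushU c t : push << c *g t >> = << c *g (face_val t : signvec 'I_n) >>.
Proof. by rewrite /push -lock mmapU malgM_def fgmulUU mulr1 mul1m. Qed.

Lemma pushD a b : push (a + b) = push a + push b.
Proof. by rewrite /push -lock; exact: mmapD. Qed.

Lemma push0 : push 0 = 0.
Proof. by rewrite /push -lock; exact: mmap0. Qed.

Lemma push_coeff a t : (push a)@_(face_val t : signvec 'I_n) = a@_t.
Proof.
have : a \in malg_on k predT by apply/malg_onP.
elim/malg_on_ind: a / => [|a b Ea Eb|c s _].
- by rewrite push0 !mcoeff0.
- by rewrite pushD !mcoeffD Ea Eb.
by rewrite pushU !mcoeffU (inj_eq val_inj).
Qed.

Lemma push_inj : injective push.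
Proof. by move=> a b E; apply/malgP=> t; rewrite -!push_coeff E. Qed.

Lemma pushMU a c t : push (a * << c *g t >>) = push a * push << c *g t >>.
Proof.
have : a \in malg_on k predT by apply/malg_onP.
elim/malg_on_ind: a / => [|a b Ea Eb|c' s _].
- by rewrite mul0r push0 [RHS]mul0r.
- rewrite [X in push X]mulrDl [LHS]pushD (pushD a b) [RHS]mulrDl.
  exact: (congr2 +%R Ea Eb).
apply: etrans (congr1 push (malg_mulU c' c s t)) _.
apply: etrans (pushU _ _) _; apply: esym.
apply: etrans (congr2 *%R (pushU c' s) (pushU c t)) _.
apply: etrans (malg_mulU _ _ _ _) _.
exact: (congr1 (fun x => mkmalgU x (c' * c))).
Qed.

(** The identity of the span of sign vectors has a preimage under the injective map [push], and the
    identity law is pulled back one monomial at a time. *)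
Lemma hemisphere_left_identity : exists2 g, g \in malg_on k RH &
  forall u, u \in malg_on k RH -> g * u = u.
Proof.
have [e [eU Le _]] :=
  span_identity_exists k hemisphere_closed hemisphere_elimination.
have [g gR gE] : exists2 g, g \in malg_on k RH & push g = e.
  elim/malg_on_ind: e / eU {Le} => [|a b [a' aR <-] [b' bR <-]|c _ /imsetP[t tR ->]].
  - by exists 0; [exact: malg_on0|rewrite push0].
  - by exists (a' + b'); [exact: malg_onD|rewrite pushD].
  - by exists << c *g t >>; [exact: malg_onU|rewrite pushU].
exists g => // u uR; rewrite -[RHS]mul1r; apply: malg_on_mulr uR => t tR.
rewrite mul1r; apply: push_inj; rewrite pushMU gE pushU Le //.
by apply: malg_onU; apply: imset_f.
Qed.

(** Equivalent to [s t = s] and [t s = t] in the face monoid. *)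
Definition same_zeros (s t : face f) : Prop := forall i, s i = Zero <-> t i = Zero.

Lemma opposite_in_hemisphere (t : face f) : generic_hyperplane f h ->
  t != mone -> t \notin RH -> exists2 s : face f, s \in RH & same_zeros s t.
Proof.
move=> [_ gen] t1 tR; have [x tx] := faceP t.
case: (sgnP (h x : R)) => hx.
- by case/hemisphereP: tR; exists x.
- have Hs : `[< exists y, theta f (- x) = theta f y >].
    by apply/asboolP; exists (- x).
  exists (Face Hs).
    by apply/hemisphereP; exists (- x); rewrite linearN oppr_gt0.
  by move=> i; rewrite tx !ffunE linearN sgnN; case: (sgn (f i x : R)).
(* Remaining case [h x = 0]: genericity is used to represent [t] by a point where [h] is positive, a
   contradiction. *)
case/hemisphereP: tR.
have x0 : x != 0.
  apply: contra t1 => /eqP x0; apply/eqP/val_inj; rewrite /= tx x0.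
  exact: theta0.
(* The hyperplanes through [x] meet in a flat containing [x != 0], so some [z] of this flat has
   [h z != 0]. *)
pose S := [set i | (f i x : R) == 0].
have /subvPn[z zX hz] : ~~ ((\bigcap_(i in S) lker (f i))%VS <= lker h)%VS.
  apply/negP => /(gen _ (ex_intro _ S erefl)) X0.
  suff: x \in (\bigcap_(i in S) lker (f i))%VS by rewrite X0 memv0; apply/negP.
  rewrite memvE; apply/subv_bigcapP=> i; rewrite inE => /eqP fx.
  by rewrite -memvE memv_ker; apply/eqP.
have fz i : (f i x : R) = 0 -> (f i z : R) = 0.
  move=> fx; move: zX; rewrite memvE => /subv_bigcapP /(_ i).
  rewrite inE fx eqxx => /(_ isT); rewrite -memvE memv_ker => /eqP.
  exact.
(* The scaling makes [h] equal to the square of [h z], hence positive. As [z] lies in the flat,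
   multiplying by its signs on the right leaves those of [x] unchanged. *)
have [w [hw wE]] := theta_mul_ext x ((h z : R) *: z).
exists w; split.
  have hz0 : 0 < (h ((h z : R) *: z) : R).
    have -> : (h ((h z : R) *: z) : R) = (h z : R) * (h z : R) by rewrite linearZ.
    by rewrite -expr2 lt_def sqrf_eq0 sqr_ge0 andbT; move: hz; rewrite memv_ker.
  by move: hw; rewrite hx sgn0 (sgn_pos hz0) /=; case: (sgnP (h w : R)).
rewrite tx -wE; apply/ffunP=> i; rewrite !ffunE.
case: (sgnP (f i x : R)) => //= /fz fz0.
have -> : (f i ((h z : R) *: z) : R) = (h z : R) * (f i z : R) by rewrite linearZ.
by rewrite fz0 mulr0 sgn0.
Qed.

(** For a face [u], the product of [s] and [u] already has a nonzero sign wherever [s] has, and [t]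
    is zero at all other coordinates. *)
Lemma same_zeros_sandwich (s t : face f) (w : {malg k[face f]}) : same_zeros s t ->
  << s >> * w * << t >> = << s >> * w.
Proof.
move=> st; have : w \in malg_on k predT by apply/malg_onP.
elim/malg_on_ind: w / => [|a b Ea Eb|c u _].
- by rewrite mulr0 mul0r.
- by rewrite mulrDr [LHS]mulrDl; exact: (congr2 +%R Ea Eb).
rewrite !malg_mulU mulr1; congr << _ *g _ >>.
apply/val_inj/ffunP=> i; rewrite !ffunE.
case si: (s i) => //=; case: (face_val u i) => //=.
by move/st: si.
Qed.

Lemma same_zeros_nilpotent (s t : face f) (w : {malg k[face f]}) :
  same_zeros s t -> (<< s >> - << t >>) * w * (<< s >> - << t >>) = 0.
Proof.
move=> st; have ts : same_zeros t s by move=> i; split=> /st.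
by apply: sandwich_sub; apply: same_zeros_sandwich.
Qed.

End Hemisphere.

(** * Quotient modules *)

Section Modules.
Variable B : nzRingType.

Section Lift.
Variables (V U : lmodType B) (S : {pred V}) (hS : submod_closed S).
Variable phi : {linear V -> U}.
Hypothesis phiS : forall v, v \in S -> phi v = 0.

Definition quotient_lift (q : quotient_module hS) : U :=
  phi (repr (q : Quotient.quot (submodule_pred hS))).

Lemma quotient_liftE v : quotient_lift (coset hS v) = phi v.
Proof.
apply/eqP; rewrite -subr_eq0 -linearB; apply/eqP/phiS.
by apply/(cosetP hS); exact: reprK.
Qed.

Lemma quotient_lift_linear : linear quotient_lift.
Proof.
move=> a p q; elim/coset_ind: p => u; elim/coset_ind: q => v.
rewrite [a *: _]quotient_scaleE -raddfD !quotient_liftE.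
exact: linearP.
Qed.

Definition quotient_map : {linear quotient_module hS -> U} :=
  HB.pack quotient_lift (GRing.isLinear.Build B (quotient_module hS) U _
    quotient_lift quotient_lift_linear).

Lemma quotient_mapE v : quotient_map (coset hS v) = phi v.
Proof. exact: quotient_liftE. Qed.
End Lift.

(** Here [S] is [B g]. The lift sends the coset of [v] to [v * (1 - g)] applied to a preimage [u0]:
    the factor [1 - g] kills [S], and it fixes the coset of 1 because [g] is in [S]. *)
Lemma projective_quotient (S : {pred B^o}) (hS : submod_closed S) (g : B) :
  g \in S -> (forall u : B, u \in S -> u * g = u) ->
  projective (quotient_module hS).
Proof.
move=> gS Sg U W p q p_surj.
have [u0 pu0] := p_surj (q (coset hS (1 : B))).
pose phi (v : B^o) : U := (v : B) *: ((1 - g) *: u0).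
have phi_linear : linear phi.
  by move=> a u v; rewrite /phi [LHS]scalerDl; congr (_ + _); apply/esym/scalerA.
pose Phi : {linear B^o -> U} :=
  HB.pack phi (GRing.isLinear.Build _ _ _ _ phi phi_linear).
have PhiS v : v \in S -> Phi v = 0.
  move=> vS; rewrite /Phi /= /phi scalerA mulrBr mulr1 Sg // subrr.
  exact: scale0r.
exists (quotient_map hS PhiS).
elim/coset_ind=> v; rewrite quotient_mapE /= /phi 2!linearZ /= pu0.
rewrite -2!linearZ /=; congr (q _).
have -> : (1 - g) *: coset hS (1 : B) = coset hS (1 : B).
  apply: etrans (quotient_scaleE hS _ _) _; apply/(cosetP hS).
  rewrite [_ *: _]mulr1 addrAC subrr add0r.
  by have := hS.2 (-1) g 0 gS hS.1; rewrite addr0 scaleN1r.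
by apply: etrans (quotient_scaleE hS _ _) _; rewrite [_ *: _]mulr1.
Qed.

(** For [S] maximal let [T = S + B n v]. If [T] misses [v], maximality gives [n v] in [S]. Otherwise
    [v - b n v] is in [S] for some [b], and multiplying by [n] leaves [n v], as [n b n = 0]. *)
Lemma square_zero_in_radical (V : lmodType B) (v : V) (n : B) :
  (forall w, n * w * n = 0) -> in_radical (n *: v).
Proof.
move=> nn S [Ssub _ Smax].
have [S0 SP] := Ssub.
pose T : {pred V} := [pred u | `[< exists b, u - (b * n) *: v \in S >]].
have Tsub : submod_closed T.
  split; first by apply/asboolP; exists 0; rewrite mul0r scale0r subr0.
  move=> a x y /asboolP[b xS] /asboolP[c yS]; apply/asboolP; exists (a * b + c).
  have := SP a _ _ xS yS.
  by rewrite scalerBr scalerA mulrA addrACA -opprD -scalerDl -mulrDl.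
have ST : {subset S <= T}.
  by move=> u uS; apply/asboolP; exists 0; rewrite mul0r scale0r subr0.
have nvT : n *: v \in T by apply/asboolP; exists 1; rewrite mul1r subrr.
have [/asboolP[b vb]|vT] := boolP (v \in T).
  have := SP n _ _ vb S0.
  by rewrite addr0 scalerBr scalerA mulrA nn scale0r subr0.
by apply: (Smax T Tsub ST) => //; exists v.
Qed.

End Modules.

(** * The projective cover *)

Lemma malg_on_right_ideal (k : fieldType) (M : monomType) (X : {pred M}) :
  (forall x y, x \in X -> mmul x y \in X) -> right_ideal (malg_on k X).
Proof.
move=> XM; split; first exact: malg_on0.
move=> a u v uX vX; apply: malg_onD => //.
have aT : (a : {malg k[M]}) \in malg_on k predT by apply/malg_onP.
by apply: malg_onM uX aT => x y xX _; apply: XM.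
Qed.

Section Augmentation.
Variables (k : fieldType) (M : monomType).
Local Notation A := {malg k[M]}.

(** Not the sum of all coefficients: the coefficient at 1 is multiplicative because a product is 1
    only if both factors are. *)
Definition augmentation (a : (A^c)^o) : unit_module k M := (a : A)@_mone.

Lemma augmentation_linear : linear augmentation.
Proof.
move=> a u v; rewrite [LHS]mcoeffD; congr (_ + _).
exact: etrans (rmorphM (mcoeff mone) (u : A) (a : A)) (mulrC _ _).
Qed.

HB.instance Definition _ := GRing.isLinear.Build A^c (A^c)^o (unit_module k M) _
  augmentation augmentation_linear.
End Augmentation.

Lemma finite_dimensional_quotient (k : fieldType) (F : finType) (M : monomType)
    (m : F -> M) (S : {pred ({malg k[M]}^c)^o}) (hS : submod_closed S) :
  (forall x, exists i, x = m i) -> finite_dimensional (quotient_module hS).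
Proof.
move=> m_surj; exists [seq coset hS << m i >> | i <- enum F].
elim/coset_ind=> a.
have : (a : {malg k[M]}) \in malg_on k predT by apply/malg_onP.
set s := [seq _ | i <- _]; have sz : size s = size (enum F) by rewrite size_map.
elim/malg_on_ind: (a : {malg k[M]}) / => [|u v [c uE] [c' vE]|c x _].
- exists (fun=> 0); rewrite [LHS]raddf0 big1 // => i _.
  by rewrite scale0r; apply: scale0r.
- exists (fun i => c i + c' i); apply: etrans (raddfD (coset hS) u v) _.
  apply: etrans (congr2 +%R uE vE) _; rewrite -big_split.
  apply: eq_bigr => i _; rewrite (scalerDl 1 (c i)).
  exact/esym/(scalerDl s`_i).
have [i ->] := m_surj x.
have ltj : (index i (enum F) < size s)%N by rewrite sz index_mem mem_enum.
exists (fun j => if j == index i (enum F) then c else 0).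
rewrite (bigD1 (Ordinal ltj)) //= eqxx big1 => [|j]; last first.
  rewrite -val_eqE /= => /negPf ->; rewrite scale0r; exact: scale0r.
rewrite addr0 (nth_map i) -?sz // nth_index ?mem_enum //.
apply: esym; apply: etrans (quotient_scaleE hS _ _) _; congr (coset hS _).
rewrite -mul_malgC mulr1; exact/esym/malgU_Cmul.
Qed.

Lemma in_radical0 (B : nzRingType) (V : lmodType B) : in_radical (0 : V).
Proof. by move=> S [[S0 _] _ _]. Qed.

Lemma in_radicalD (B : nzRingType) (V : lmodType B) (u v : V) :
  in_radical u -> in_radical v -> in_radical (u + v).
Proof.
move=> Ru Rv S maxS; have [[_ SP] _ _] := maxS.
by rewrite -[u]scale1r; apply: SP; [apply: Ru|apply: Rv].
Qed.

Lemma coset_in_radical (R : realType) (k : fieldType) (d n : nat)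
    (f : 'I_n -> 'Hom('rV[R]_d, R^o)) (h : 'Hom('rV[R]_d, R^o))
    (hI : right_ideal (malg_on k (visual_hemisphere f h))) :
  generic_hyperplane f h ->
  forall a : {malg k[face f]}, a@_mone = 0 -> in_radical (coset hI a).
Proof.
move=> gen a a1.
have aX : a \in malg_on k (predC1 (mone : face f)).
  by apply/malg_onP=> t; apply: contra => /eqP ->; apply/eqP.
elim/malg_on_ind: a / aX {a1} => [|u v Ru Rv|c t t1].
- by rewrite raddf0; exact: in_radical0.
- by have := in_radicalD Ru Rv; rewrite -raddfD.
have [tR|tR] := boolP (t \in visual_hemisphere f h).
  have -> : coset hI << c *g t >> = 0.
    rewrite -[RHS](raddf0 (coset hI)); apply/(cosetP hI).
    by rewrite subr0; apply: malg_onU.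
  exact: in_radical0.
have [s sR st] := opposite_in_hemisphere gen t1 tR.
have ts : same_zeros t s by move=> i; split=> /st.
(* Scalars act on the right, so this is [c] times [t - s], congruent to [c t] since [s] is in the
   hemisphere. *)
have -> : coset hI << c *g t >> =
    ((<< t >> - << s >> : {malg k[face f]}) : {malg k[face f]}^c) *:
      coset hI (<< c *g mone >> : {malg k[face f]}).
  apply: esym; apply: etrans (quotient_scaleE hI _ _) _; apply/(cosetP hI).
  rewrite [_ *: _]mulrBr -2!malgU_mulC addrAC subrr add0r.
  by apply: malg_onN; apply: malg_onU.
(* The product of the converse ring is read backwards, hence the reassociation. *)
apply: square_zero_in_radical => w; rewrite -mulrA.
exact: same_zeros_nilpotent.
Qed.

Theorem theorem8p7 (R : realType) (k : fieldType) (d n : nat)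
    (f : 'I_n -> 'Hom('rV[R]_d, R^o)) (h : 'Hom('rV[R]_d, R^o)) :
  essential_arrangement f -> generic_hyperplane f h ->
  exists hI : right_ideal (malg_on k (visual_hemisphere f h)),
  exists psi : {linear quotient_module hI -> unit_module k (face f)},
    [/\ psi (coset hI (1 : {malg k[face f]})) = (1 : k),
        forall t : face f, t != mone ->
          psi (coset hI (<< t >> : {malg k[face f]})) = 0
      & projective_cover psi].
Proof.
move=> ess gen.
have hI : right_ideal (malg_on k (visual_hemisphere f h)).
  by apply: malg_on_right_ideal => x y xR; exact: hemisphereM.
exists hI.
have aug0 v : v \in malg_on k (visual_hemisphere f h) ->
    augmentation (v : ({malg k[face f]}^c)^o) = 0.
  move=> /malg_onP vR; apply/eqP/negPn/negP => /vR.
  exact/negP/one_notin_hemisphere.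
pose psi := quotient_map hI aug0.
have psiE a : psi (coset hI a) = augmentation a by exact: quotient_mapE.
have [g gR gL] := hemisphere_left_identity k f h.
exists psi; split.
- by rewrite psiE; apply: etrans (mcoeff1 _ _) _; rewrite eqxx.
- move=> t t1; rewrite psiE.
  by rewrite [LHS](mcoeffU1 k t (mone : face f)) (negPf t1).
split.
- by apply: (@finite_dimensional_quotient k (face f) (face f) id _ hI) => t;
    exists t.
(* A left identity in the algebra is a right identity in the converse ring. *)
- apply: (@projective_quotient {malg k[face f]}^c _ hI g gR).
  by move=> u /gL.
- move=> c; exists (coset hI << (c : k) *g mone >>); rewrite psiE.
  exact: mcoeffUU.
- elim/coset_ind=> a; rewrite psiE; exact: coset_in_radical.
Qed.
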